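(* Let $(\Omega,\mathcal{F},P)$ be a probability space and let $(E,\|\cdot\|)$ be a random normed module over $\mathbb{C}$ with base $(\Omega,\mathcal{F},P)$. Let $J:E\to E^{**}$ be the random natural embedding, defined by $J(x)(g)=g(x)$ for all $x\in E$ and $g\in E^{*}$. Then the closure of $J(E)$ in $E^{**}$ with respect to the $(\varepsilon,\lambda)$ weak star topology $\sigma_{(\varepsilon,\lambda)}(E^{**},E^{*})$ is $E^{**}$.
   Context: $L^{0}(\mathcal{F},K)$ ($K=\mathbb{R}$ or $\mathbb{C}$) is the algebra of a.s.-equivalence classes of $K$-valued $\mathcal{F}$-measurable functions on $\Omega$. $L^0(\mathcal{F},\mathbb{R})$ is ordered by $\xi\leqslant\eta$ iff $\xi\leqslant\eta$ a.s.; suprema $\vee$ are taken in this (Dedekind complete) order. $L^{0}_{+}=\{\xi\in L^{0}(\mathcal{F},\mathbb{R}):\xi\geqslant 0\}$. Random normed (RN) module over $K$ with base $(\Omega,\mathcal{F},P)$: a left module $E$ over the algebra $L^{0}(\mathcal{F},K)$ with a map $\|\cdot\|:E\to L^{0}_{+}$ such that $\|x\|=0$ iff $x=0$; $\|\xi x\|=|\xi|\,\|x\|$ for $\xi\in L^{0}(\mathcal{F},K)$, $x\in E$; and $\|x+y\|\leqslant\|x\|+\|y\|$. Random conjugate space $E^{*}$: all linear operators $f:E\to L^{0}(\mathcal{F},K)$ for which there is $\xi\in L^{0}_{+}$ with $|f(x)|\leqslant\xi\|x\|$ for all $x\in E$; it is an RN module under $(\xi\cdot f)(x)=\xi f(x)$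 and $\|f\|^{*}=\vee\{|f(y)|: y\in E,\ \|y\|\leqslant 1\}$. $E^{**}=(E^{*})^{*}$. For an RN module $F$ (applied here with $F=E^{*}$), the $(\varepsilon,\lambda)$ weak star topology $\sigma_{(\varepsilon,\lambda)}(F^{*},F)$ on $F^{*}$ is the translation-invariant topology having as a neighborhood base at $0$ the sets $\{g\in F^{*}: P([|g(y_i)|<\varepsilon])>1-\lambda,\ 1\leqslant i\leqslant n\}$, for $n\geq 1$, $y_1,\dots,y_n\in F$, and real numbers $\varepsilon>0$, $0<\lambda<1$ (neighborhoods of other points are translates). Here $[\,|g(y_i)|<\varepsilon]$ is the (class of the) event where $|g(y_i)|<\varepsilon$. *)

(* Defs.v *)
From HB Require Import structures.
From mathcomp Require Import all_boot all_order all_algebra.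
From mathcomp Require Import all_classical all_reals all_analysis.
From mathcomp Require Import measurable_realfun complex ring lra.

Set Implicit Arguments.
Unset Strict Implicit.
Unset Printing Implicit Defensive.

Import Order.TTheory GRing.Theory Num.Theory.
Import numFieldNormedType.Exports.
Import ComplexField.Normc.

Local Open Scope classical_set_scope.
Local Open Scope ring_scope.
Local Open Scope quotient_scope.

(* C is measured as R^2: the sigma-algebra is pulled back along
   z |-> (Re z, Im z), so f : T -> C is measurable iff Re f and Im f are. *)
Section complex_measurable.
Variable R : realType.
Local Notation Re := (@complex.Re R).
Local Notation Im := (@complex.Im R).

Definition complex_pair (z : R[i]) : R * R := (Re z, Im z).

HB.instance Definition _ := isPointed.Build R[i] 0.
HB.instance Definition _ := Measurable.copy R[i]
  (g_sigma_algebra_preimageType complex_pair).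

Lemma measurable_complex_pair : measurable_fun [set: R[i]] complex_pair.
Proof. by move=> _ B mB; rewrite setTI; exists B => //; rewrite setTI. Qed.

Lemma measurable_Re : measurable_fun [set: R[i]] Re.
Proof. exact: (measurableT_comp measurable_fst measurable_complex_pair). Qed.

Lemma measurable_Im : measurable_fun [set: R[i]] Im.
Proof. exact: (measurableT_comp measurable_snd measurable_complex_pair). Qed.

Lemma measurable_complexP d (T : measurableType d) (f : T -> R[i]) :
  measurable_fun [set: T] f <->
  measurable_fun [set: T] (fun t => Re (f t)) /\
  measurable_fun [set: T] (fun t => Im (f t)).
Proof.
split=> [mf|[mr mi]].
  split; [exact: (measurableT_comp measurable_Re)
         |exact: (measurableT_comp measurable_Im)].
have mp : measurable_fun [set: T] (complex_pair \o f).
  exact: measurable_fun_pair mr mi.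
move=> _ _ [B mB <-]; rewrite [X in _ `&` (f @^-1` X)]setTI -comp_preimage.
exact: mp.
Qed.

Lemma measurable_complexD :
  measurable_fun [set: R[i] * R[i]] (fun u : R[i] * R[i] => u.1 + u.2).
Proof.
apply/measurable_complexP; split.
- rewrite [X in measurable_fun _ X](_ : _ =
    (Re \o fst) \+ (Re \o snd)); last first.
    by apply/funext => -[[a b] [c e]].
  by apply: measurable_funD; apply: (measurableT_comp measurable_Re).
- rewrite [X in measurable_fun _ X](_ : _ =
    (Im \o fst) \+ (Im \o snd)); last first.
    by apply/funext => -[[a b] [c e]].
  by apply: measurable_funD; apply: (measurableT_comp measurable_Im).
Qed.

Lemma measurable_complexN : measurable_fun [set: R[i]] (fun u : R[i] => - u).
Proof.
apply/measurable_complexP; split.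
- rewrite [X in measurable_fun _ X](_ : _ = -%R \o Re); last first.
    by apply/funext => -[a b].
  exact: (measurableT_comp (@oppr_measurable R _) measurable_Re).
- rewrite [X in measurable_fun _ X](_ : _ = -%R \o Im); last first.
    by apply/funext => -[a b].
  exact: (measurableT_comp (@oppr_measurable R _) measurable_Im).
Qed.

Lemma measurable_complexM :
  measurable_fun [set: R[i] * R[i]] (fun u : R[i] * R[i] => u.1 * u.2).
Proof.
have mr1 : measurable_fun [set: R[i] * R[i]] (Re \o fst).
  by apply: (measurableT_comp measurable_Re).
have mr2 : measurable_fun [set: R[i] * R[i]] (Re \o snd).
  by apply: (measurableT_comp measurable_Re).
have mi1 : measurable_fun [set: R[i] * R[i]] (Im \o fst).
  by apply: (measurableT_comp measurable_Im).
have mi2 : measurable_fun [set: R[i] * R[i]] (Im \o snd).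
  by apply: (measurableT_comp measurable_Im).
apply/measurable_complexP; split.
- rewrite [X in measurable_fun _ X](_ : _ =
    ((Re \o fst) \* (Re \o snd)) \-
    ((Im \o fst) \* (Im \o snd))); last first.
    by apply/funext => -[[a b] [c e]].
  by apply: measurable_funB; apply: measurable_funM.
- rewrite [X in measurable_fun _ X](_ : _ =
    ((Re \o fst) \* (Im \o snd)) \+
    ((Im \o fst) \* (Re \o snd))); last first.
    by apply/funext => -[[a b] [c e]].
  by apply: measurable_funD; apply: measurable_funM.
Qed.

Lemma measurable_normc : measurable_fun [set: R[i]] (@normc R).
Proof.
rewrite (_ : @normc R = Num.sqrt \o
    (fun z => Re z ^+ 2 + Im z ^+ 2)); last first.
  by apply/funext => -[a b].
apply: measurableT_comp; first exact: (continuous_measurable_fun (@sqrt_continuous R)).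
by apply: measurable_funD; apply: measurable_funX;
  [exact: measurable_Re|exact: measurable_Im].
Qed.

Lemma measurable_real_complex : measurable_fun [set: R] (fun x : R => x%:C%C).
Proof.
by apply/measurable_complexP; split; [exact: measurable_id|exact: measurable_cst].
Qed.

End complex_measurable.

Section L0.
Context d (T : measurableType d) (R : realType) (P : probability T R).

Definition L0 d' (U : measurableType d') : Type := {mfun_ P, T >-> U}.

Section L0_theory.
Context d' (U : measurableType d').

HB.instance Definition _ := Choice.on (L0 U).
HB.instance Definition _ := EqQuotient.on (L0 U).

Definition L0_repr (xi : L0 U) : {mfun T >-> U} := repr xi.
Coercion L0_repr : L0 >-> MeasurableFun.type.

Definition L0_class (f : {mfun T >-> U}) : L0 U := \pi_(L0 U) f.

Definition mfun_of (f : T -> U) (mf : measurable_fun [set: T] f) :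
  {mfun T >-> U} := mfun_Sub (mem_set mf).

Lemma L0_classP (f g : {mfun T >-> U}) :
  L0_class f = L0_class g <-> {ae P, forall t, f t = g t}.
Proof.
split=> [/eqmodP/asboolP|fg]; first by apply: filterS => t /(_ I).
by apply/eqmodP/asboolP; apply: filterS fg.
Qed.

Lemma L0_reprK (xi : L0 U) : L0_class xi = xi.
Proof. exact: reprK. Qed.

Lemma L0_classK (f : {mfun T >-> U}) : {ae P, forall t, L0_class f t = f t}.
Proof. by apply/L0_classP; rewrite L0_reprK. Qed.

Lemma L0P (xi eta : L0 U) : xi = eta <-> {ae P, forall t, xi t = eta t}.
Proof. by rewrite -L0_classP !L0_reprK. Qed.

Definition L0_cst (u : U) : L0 U := L0_class (cst u).

Lemma L0_cstE (u : U) : {ae P, forall t, L0_cst u t = u}.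
Proof. exact: L0_classK. Qed.

End L0_theory.

Section L0_lift.
Context d1 (U : measurableType d1) d2 (V : measurableType d2)
  d3 (W : measurableType d3).

Definition L0_lift1 (f : U -> V) (mf : measurable_fun [set: U] f) (xi : L0 U) :
  L0 V := L0_class (mfun_of (measurableT_comp mf (@measurable_funPT _ _ _ _ xi))).

Lemma L0_lift1E f (mf : measurable_fun [set: U] f) xi :
  {ae P, forall t, L0_lift1 mf xi t = f (xi t)}.
Proof. exact: L0_classK. Qed.

Definition L0_lift2 (f : U -> V -> W)
    (mf : measurable_fun [set: U * V] (fun u => f u.1 u.2))
    (xi : L0 U) (eta : L0 V) : L0 W :=
  L0_class (mfun_of (measurableT_comp mf
    (measurable_fun_pair (@measurable_funPT _ _ _ _ xi)
                         (@measurable_funPT _ _ _ _ eta)))).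

Lemma L0_lift2E f (mf : measurable_fun [set: U * V] (fun u => f u.1 u.2)) xi eta :
  {ae P, forall t, L0_lift2 mf xi eta t = f (xi t) (eta t)}.
Proof. exact: L0_classK. Qed.

End L0_lift.
End L0.

Lemma filter4 (T : Type) (F : set_system T) (FF : Filter F) (A B C D Q : set T) :
  F A -> F B -> F C -> F D -> (forall t, A t -> B t -> C t -> D t -> Q t) -> F Q.
Proof.
move=> FA FB FC FD ABCDQ; apply: filterS3 (filterI FA FB) FC FD => t [? ?] ? ?.
exact: ABCDQ.
Qed.

Lemma filter5 (T : Type) (F : set_system T) (FF : Filter F) (A B C D E Q : set T) :
  F A -> F B -> F C -> F D -> F E ->
  (forall t, A t -> B t -> C t -> D t -> E t -> Q t) -> F Q.
Proof.
move=> FA FB FC FD FE ABCDEQ.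
apply: filterS3 (filterI FA FB) (filterI FC FD) FE => t [? ?] [? ?] ?.
exact: ABCDEQ.
Qed.

Lemma probability_ae_False d (T : measurableType d) (R : realType)
  (P : probability T R) : {ae P, forall t : T, False} -> False.
Proof.
move=> [N [mN PN0 FN]].
have NT : N = setT by apply/seteqP; split => // t _; apply: FN => /=; exact.
by have /eqP := probability_setT P; rewrite -NT PN0 eq_sym onee_eq0.
Qed.

Section real_ring_measurable.
Variable R : realType.

Lemma measurable_realD : measurable_fun [set: R * R] (fun u : R * R => u.1 + u.2).
Proof. exact: measurable_funD measurable_fst measurable_snd. Qed.

Lemma measurable_realN : measurable_fun [set: R] (fun u : R => - u).
Proof. exact: oppr_measurable. Qed.

Lemma measurable_realM : measurable_fun [set: R * R] (fun u : R * R => u.1 * u.2).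
Proof. exact: measurable_funM measurable_fst measurable_snd. Qed.
End real_ring_measurable.

Definition L0R d (T : measurableType d) (R : realType) (P : probability T R) :
  Type := L0 P R.
Identity Coercion L0R_L0 : L0R >-> L0.

Section L0_real_ring.
Context d (T : measurableType d) (R : realType) (P : probability T R).

HB.instance Definition _ := Choice.on (L0R P).
HB.instance Definition _ := EqQuotient.on (L0R P).

Implicit Types xi eta zeta : L0R P.

Let zero : L0R P := L0_cst P (0 : R).
Let one : L0R P := L0_cst P (1 : R).
Let opp : L0R P -> L0R P := L0_lift1 (@measurable_realN R).
Let add : L0R P -> L0R P -> L0R P :=
  L0_lift2 (f := fun x y : R => x + y) (@measurable_realD R).
Let mul : L0R P -> L0R P -> L0R P :=
  L0_lift2 (f := fun x y : R => x * y) (@measurable_realM R).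

Let addE a b : {ae P, forall t, add a b t = a t + b t}.
Proof. exact: L0_lift2E. Qed.
Let oppE a : {ae P, forall t, opp a t = - a t}.
Proof. exact: L0_lift1E. Qed.
Let mulE a b : {ae P, forall t, mul a b t = a t * b t}.
Proof. exact: L0_lift2E. Qed.

Let addA : associative add.
Proof.
move=> a b c; apply/L0P.
apply: filter4 (addE a (add b c)) (addE b c)
  (addE (add a b) c) (addE a b) _ => t -> -> -> ->.
by rewrite addrA.
Qed.

Let addC : commutative add.
Proof.
move=> a b; apply/L0P.
by apply: filterS2 (addE a b) (addE b a) => t -> ->; rewrite addrC.
Qed.

Let add0 : left_id zero add.
Proof.
move=> a; apply/L0P.
by apply: filterS2 (addE zero a) (L0_cstE P (0 : R)) => t -> ->; rewrite add0r.
Qed.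

Let addN : left_inverse zero opp add.
Proof.
move=> a; apply/L0P.
by apply: filterS3 (addE (opp a) a) (oppE a)
  (L0_cstE P (0 : R)) => t -> -> ->; rewrite addNr.
Qed.

HB.instance Definition _ := GRing.isZmodule.Build (L0R P) addA addC add0 addN.

Let mulA : associative mul.
Proof.
move=> a b c; apply/L0P.
apply: filter4 (mulE a (mul b c)) (mulE b c)
  (mulE (mul a b) c) (mulE a b) _ => t -> -> -> ->.
by rewrite mulrA.
Qed.

Let mulC : commutative mul.
Proof.
move=> a b; apply/L0P.
by apply: filterS2 (mulE a b) (mulE b a) => t -> ->; rewrite mulrC.
Qed.

Let mul1 : left_id one mul.
Proof.
move=> a; apply/L0P.
by apply: filterS2 (mulE one a) (L0_cstE P (1 : R)) => t -> ->; rewrite mul1r.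
Qed.

Let mulD : left_distributive mul +%R.
Proof.
move=> a b c; apply/L0P.
apply: filter5 (mulE (add a b) c) (addE a b)
  (addE (mul a c) (mul b c)) (mulE a c) (mulE b c) _.
by move=> t -> -> -> -> ->; rewrite mulrDl.
Qed.

Let one_neq0 : one != zero.
Proof.
apply/eqP => /L0P h; apply: (@probability_ae_False _ _ _ P).
by apply: filterS3 h (L0_cstE P (1 : R)) (L0_cstE P (0 : R)) => t -> /= -> /eqP;
  rewrite oner_eq0.
Qed.

HB.instance Definition _ := GRing.Zmodule_isComNzRing.Build (L0R P)
  mulA mulC mul1 mulD one_neq0.

Lemma L0R_0E : {ae P, forall t, (0 : L0R P) t = 0}.
Proof. exact: L0_cstE. Qed.

Lemma L0R_1E : {ae P, forall t, (1 : L0R P) t = 1}.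
Proof. exact: L0_cstE. Qed.

Lemma L0R_DE xi eta : {ae P, forall t, (xi + eta : L0R P) t = xi t + eta t}.
Proof. exact: L0_lift2E. Qed.

Lemma L0R_NE xi : {ae P, forall t, (- xi : L0R P) t = - xi t}.
Proof. exact: L0_lift1E. Qed.

Lemma L0R_ME xi eta : {ae P, forall t, (xi * eta : L0R P) t = xi t * eta t}.
Proof. exact: L0_lift2E. Qed.

End L0_real_ring.

Definition L0C d (T : measurableType d) (R : realType) (P : probability T R) :
  Type := L0 P R[i].
Identity Coercion L0C_L0 : L0C >-> L0.

Section L0_complex_ring.
Context d (T : measurableType d) (R : realType) (P : probability T R).

HB.instance Definition _ := Choice.on (L0C P).
HB.instance Definition _ := EqQuotient.on (L0C P).

Implicit Types xi eta zeta : L0C P.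

Let zero : L0C P := L0_cst P (0 : R[i]).
Let one : L0C P := L0_cst P (1 : R[i]).
Let opp : L0C P -> L0C P := L0_lift1 (@measurable_complexN R).
Let add : L0C P -> L0C P -> L0C P :=
  L0_lift2 (f := fun x y : R[i] => x + y) (@measurable_complexD R).
Let mul : L0C P -> L0C P -> L0C P :=
  L0_lift2 (f := fun x y : R[i] => x * y) (@measurable_complexM R).

Let addE a b : {ae P, forall t, add a b t = a t + b t}.
Proof. exact: L0_lift2E. Qed.
Let oppE a : {ae P, forall t, opp a t = - a t}.
Proof. exact: L0_lift1E. Qed.
Let mulE a b : {ae P, forall t, mul a b t = a t * b t}.
Proof. exact: L0_lift2E. Qed.

Let addA : associative add.
Proof.
move=> a b c; apply/L0P.
apply: filter4 (addE a (add b c)) (addE b c)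
  (addE (add a b) c) (addE a b) _ => t -> -> -> ->.
by rewrite addrA.
Qed.

Let addC : commutative add.
Proof.
move=> a b; apply/L0P.
by apply: filterS2 (addE a b) (addE b a) => t -> ->; rewrite addrC.
Qed.

Let add0 : left_id zero add.
Proof.
move=> a; apply/L0P.
by apply: filterS2 (addE zero a) (L0_cstE P (0 : R[i])) => t -> ->; rewrite add0r.
Qed.

Let addN : left_inverse zero opp add.
Proof.
move=> a; apply/L0P.
by apply: filterS3 (addE (opp a) a) (oppE a)
  (L0_cstE P (0 : R[i])) => t -> -> ->; rewrite addNr.
Qed.

HB.instance Definition _ := GRing.isZmodule.Build (L0C P) addA addC add0 addN.

Let mulA : associative mul.
Proof.
move=> a b c; apply/L0P.
apply: filter4 (mulE a (mul b c)) (mulE b c)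
  (mulE (mul a b) c) (mulE a b) _ => t -> -> -> ->.
by rewrite mulrA.
Qed.

Let mulC : commutative mul.
Proof.
move=> a b; apply/L0P.
by apply: filterS2 (mulE a b) (mulE b a) => t -> ->; rewrite mulrC.
Qed.

Let mul1 : left_id one mul.
Proof.
move=> a; apply/L0P.
by apply: filterS2 (mulE one a) (L0_cstE P (1 : R[i])) => t -> ->; rewrite mul1r.
Qed.

Let mulD : left_distributive mul +%R.
Proof.
move=> a b c; apply/L0P.
apply: filter5 (mulE (add a b) c) (addE a b)
  (addE (mul a c) (mul b c)) (mulE a c) (mulE b c) _.
by move=> t -> -> -> -> ->; rewrite mulrDl.
Qed.

Let one_neq0 : one != zero.
Proof.
apply/eqP => /L0P h; apply: (@probability_ae_False _ _ _ P).
by apply: filterS3 h (L0_cstE P (1 : R[i])) (L0_cstE P (0 : R[i])) => t -> /= -> /eqP;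
  rewrite oner_eq0.
Qed.

HB.instance Definition _ := GRing.Zmodule_isComNzRing.Build (L0C P)
  mulA mulC mul1 mulD one_neq0.

Lemma L0C_0E : {ae P, forall t, (0 : L0C P) t = 0}.
Proof. exact: L0_cstE. Qed.

Lemma L0C_1E : {ae P, forall t, (1 : L0C P) t = 1}.
Proof. exact: L0_cstE. Qed.

Lemma L0C_DE xi eta : {ae P, forall t, (xi + eta : L0C P) t = xi t + eta t}.
Proof. exact: L0_lift2E. Qed.

Lemma L0C_NE xi : {ae P, forall t, (- xi : L0C P) t = - xi t}.
Proof. exact: L0_lift1E. Qed.

Lemma L0C_ME xi eta : {ae P, forall t, (xi * eta : L0C P) t = xi t * eta t}.
Proof. exact: L0_lift2E. Qed.

End L0_complex_ring.

Section L0R_order.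
Context d (T : measurableType d) (R : realType) (P : probability T R).
Implicit Types xi eta zeta : L0R P.

Let le xi eta := `[< {ae P, forall t, xi t <= eta t} >].

Let le_refl : reflexive le.
Proof. by move=> xi; apply/asboolP; apply: aeW => t. Qed.

Let le_anti : antisymmetric le.
Proof.
move=> xi eta /andP[/asboolP h1 /asboolP h2]; apply/L0P.
by apply: filterS2 h1 h2 => t h1 h2; apply: le_anti; rewrite h1.
Qed.

Let le_trans : transitive le.
Proof.
move=> eta xi zeta /asboolP h1 /asboolP h2; apply/asboolP.
by apply: filterS2 h1 h2 => t; exact: le_trans.
Qed.

HB.instance Definition _ :=
  Order.Le_isPOrder.Build ring_display (L0R P) le_refl le_anti le_trans.

Lemma L0R_leP xi eta : xi <= eta <-> {ae P, forall t, xi t <= eta t}.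
Proof. by split=> [/asboolP|h]; [|apply/asboolP]. Qed.

End L0R_order.

Section L0R_dedekind.
Context d (T : measurableType d) (R : realType) (P : probability T R).
Variables (A : set (L0R P)) (a0 b : L0R P).
Hypotheses (Aa0 : A a0) (Ab : ubound A b).

Let m (l : seq (L0R P)) (t : T) : R :=
  foldr (fun (a : L0R P) x => Num.max (a t) x) (a0 t) l.

Let mm l : measurable_fun [set: T] (m l).
Proof.
elim: l => [|a l ih]; first exact: measurable_funPT.
by apply: measurable_maxr => //; exact: measurable_funPT.
Qed.

Let psi (x : R) : R := atan x + pi / 2.

Let psi_ge0 x : 0 <= psi x.
Proof. by have := atan_gtNpi2 x; rewrite /psi; lra. Qed.

Let psi_le x : psi x <= pi.
Proof. by have := atan_ltpi2 x; rewrite /psi; lra. Qed.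

Let psi_lt : {homo psi : x y / x < y}.
Proof. by move=> x y xy; rewrite /psi ltrD2r lt_atan. Qed.

Let psi_mono : {mono psi : x y / x <= y}.
Proof. exact: le_mono. Qed.

Let mpsi : measurable_fun [set: R] psi.
Proof.
apply: measurable_funD; last exact: measurable_cst.
by apply: continuous_measurable_fun => x; exact: continuous_atan.
Qed.

Let Phi l : \bar R := (\int[P]_t (psi (m l t))%:E)%E.

Let mpsim l : measurable_fun [set: T] (fun t => (psi (m l t))%:E).
Proof. by apply/measurable_EFinP; exact: (measurableT_comp mpsi (mm l)). Qed.

Let Phi_ge0 l : (0 <= Phi l)%E.
Proof. by apply: integral_ge0 => t _; rewrite lee_fin. Qed.

Let Phi_le l : (Phi l <= pi%:E)%E.
Proof.
rewrite -[leRHS]mule1 -(probability_setT P) -integral_cst//.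
apply: ge0_le_integral => //.
- by move=> t _; rewrite lee_fin.
- by move=> t _; rewrite lee_fin.
Qed.

Let inA (l : seq (L0R P)) := forall a, a \in l -> A a.
Let alpha := ereal_sup [set Phi l | l in inA].

Let inA0 : inA [::]. Proof. by []. Qed.

Let alpha_fin : alpha \is a fin_num.
Proof.
rewrite ge0_fin_numE.
  rewrite (@le_lt_trans _ _ pi%:E) ?ltry//.
  by apply: ge_ereal_sup => _ [l _ <-].
by rewrite (le_trans (Phi_ge0 [::]))//; apply: ereal_sup_ubound; exists [::].
Qed.

Let exL n : exists l, inA l /\ (alpha - n.+1%:R^-1%:E < Phi l)%E.
Proof.
have [|x [l Al <-] h] := @ub_ereal_sup_adherent _ [set Phi l | l in inA] n.+1%:R^-1 _ alpha_fin.
  by rewrite invr_gt0.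
by exists l.
Qed.

Let L n : seq (L0R P) := sval (cid (exL n)).
Let LA n : inA (L n). Proof. by rewrite /L; case: cid => l []. Qed.
Let LI n : (alpha - n.+1%:R^-1%:E < Phi (L n))%E.
Proof. by rewrite /L; case: cid => l []. Qed.

Let s (t : T) : \bar R := esups (fun n => (m (L n) t)%:E) 0.
Let h (t : T) : R := fine (s t).

Let mh : measurable_fun [set: T] h.
Proof.
apply: measurableT_comp; first exact: fine_measurable.
apply: (@measurable_fun_esups _ _ _ _ (fun n t => (m (L n) t)%:E)) => n.
by apply/measurable_EFinP; exact: mm.
Qed.

Let m_le (c : L0R P) l : ubound A c -> inA l -> {ae P, forall t, m l t <= c t}.
Proof.
move=> Ac; elim: l => [|a l ih] Al; first by apply/L0R_leP; exact: Ac.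
have /L0R_leP h1 : a <= c by apply/Ac/Al; rewrite mem_head.
have h2 : {ae P, forall t, m l t <= c t}.
  by apply: ih => x xl; apply: Al; rewrite in_cons xl orbT.
by apply: filterS2 h1 h2 => t h1 h2; rewrite /= ge_max h1.
Qed.

Let h_ge : {ae P, forall t, forall n, m (L n) t <= h t}.
Proof.
have /ae_foralln : forall n, {ae P, forall t, m (L n) t <= b t}.
  by move=> n; exact: m_le.
apply: filterS => t bt n.
have sge k : ((m (L k) t)%:E <= s t)%E by apply: ereal_sup_ubound; exists k.
have sle : (s t <= (b t)%:E)%E.
  by apply: ge_ereal_sup => _ [k _ <-]; rewrite lee_fin.
rewrite -lee_fin fineK// fin_real// (lt_le_trans _ (sge 0%N)) ?ltNyr//=.
by rewrite (le_lt_trans sle) ?ltry.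
Qed.

Let h_le (c : L0R P) : ubound A c -> {ae P, forall t, h t <= c t}.
Proof.
move=> Ac.
have /ae_foralln h1 : forall n, {ae P, forall t, m (L n) t <= c t}.
  by move=> n; exact: m_le.
apply: filterS h1 => t ct.
have sge k : ((m (L k) t)%:E <= s t)%E by apply: ereal_sup_ubound; exists k.
have sle : (s t <= (c t)%:E)%E.
  by apply: ge_ereal_sup => _ [k _ <-]; rewrite lee_fin.
rewrite -lee_fin fineK// fin_real// (lt_le_trans _ (sge 0%N)) ?ltNyr//=.
by rewrite (le_lt_trans sle) ?ltry.
Qed.

Let h_ub (a : L0R P) : A a -> {ae P, forall t, a t <= h t}.
Proof.
move=> Aa; pose D t : R := psi (Num.max (a t) (h t)) - psi (h t).
have D0 t : 0 <= D t by rewrite subr_ge0 psi_mono le_max lexx orbT.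
have mD : measurable_fun [set: T] D.
  apply: measurable_funB; last exact: (measurableT_comp mpsi mh).
  apply: (measurableT_comp mpsi); apply: measurable_maxr mh.
  exact: measurable_funPT.
have DI n : (\int[P]_t (D t)%:E + Phi (L n) <= Phi (a :: L n))%E.
  rewrite /Phi -ge0_integralD//; last 3 first.
  - by move=> t _; rewrite lee_fin.
  - exact/measurable_EFinP.
  - by move=> t _; rewrite lee_fin.
  apply: ae_ge0_le_integral => //.
  - by move=> t _; rewrite -EFinD lee_fin addr_ge0.
  - by apply: emeasurable_funD => //; exact/measurable_EFinP.
  - by move=> t _; rewrite lee_fin.
  apply: filterS h_ge => t /(_ n) mt _; rewrite -EFinD lee_fin /D /=.
  have [ah|ha] := leP (a t) (h t).
    by rewrite subrr add0r psi_mono le_max lexx orbT.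
  rewrite max_l ?(le_trans mt (ltW ha))//.
  have : psi (m (L n) t) <= psi (h t) by rewrite psi_mono.
  lra.
have D_eq0 : (\int[P]_t `|(D t)%:E| = 0)%E.
  under eq_integral => t _ do rewrite gee0_abs ?lee_fin//.
  apply/eqP; rewrite eq_le integral_ge0 ?andbT; last by move=> t _; rewrite lee_fin.
  apply/lee_addgt0Pr => e e0; rewrite add0e.
  have [n] := ltr_add_invr e0; rewrite add0r => ne.
  have aI : (Phi (a :: L n) <= alpha)%E.
    apply: ereal_sup_ubound; exists (a :: L n) => // x.
    by rewrite in_cons => /predU1P[->//|]; exact: LA.
  have If : Phi (L n) \is a fin_num.
    by rewrite ge0_fin_numE// (le_lt_trans (Phi_le _))// ltry.
  have := le_trans (DI n) aI; rewrite -leeBrDr// => /le_trans; apply.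
  have := LI n; rewrite lteBlDr// => /ltW h1.
  rewrite leeBlDr//; apply: (le_trans h1); rewrite addeC leeD2r//.
  by rewrite lee_fin ltW.
have /ae_eq_integral_abs : measurable_fun [set: T] (EFin \o D).
  exact/measurable_EFinP.
move=> /(_ P measurableT)[+ _] => /(_ D_eq0); apply: filterS => t /(_ I).
move=> /= [] /eqP; rewrite subr_eq0 => /eqP Dt.
by rewrite leNgt; apply/negP => ha; have := psi_lt ha;
  rewrite -Dt max_l ?ltxx// ltW.
Qed.

Lemma L0R_sup_exists : supremums A !=set0.
Proof.
exists (L0_class P (mfun_of mh)); split=> [a Aa|c Ac]; apply/L0R_leP.
- by apply: filterS2 (L0_classK P (mfun_of mh)) (h_ub Aa) => t ->.
- by apply: filterS2 (L0_classK P (mfun_of mh)) (h_le Ac) => t ->.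
Qed.

End L0R_dedekind.

Lemma ae_use d (T : measurableType d) (R : realType) (P : probability T R)
    (A B : T -> Prop) :
  {ae P, forall t, A t} -> {ae P, forall t, A t -> B t} -> {ae P, forall t, B t}.
Proof. by move=> hA hAB; apply: filterS2 hAB hA => t; exact. Qed.

Lemma normc_ge0 (R : rcfType) (z : R[i]) : 0 <= normc z.
Proof. by case: z => x y; exact: sqrtr_ge0. Qed.

Lemma measurable_realV (R : realType) : measurable_fun [set: R] (fun x : R => x^-1).
Proof.
rewrite -(setUv [set (0 : R)]); apply/measurable_funU => //.
  exact: measurableC.
split; first exact: measurable_fun_set1.
apply: open_continuous_measurable_fun.
  exact/closed_openC/closed_eq.
by move=> x /[!inE]/= /eqP x0; apply: inv_continuous.
Qed.

Section L0_abs.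
Context d (T : measurableType d) (R : realType) (P : probability T R).

Definition L0_abs (xi : L0C P) : L0R P := L0_lift1 (@measurable_normc R) xi.

Lemma L0_absE xi : {ae P, forall t, L0_abs xi t = normc (xi t)}.
Proof. exact: L0_lift1E. Qed.

End L0_abs.

HB.mixin Record Lmodule_isRNModule d (T : measurableType d) (R : realType)
    (P : probability T R) E & GRing.Lmodule (L0C P) E := {
  rnorm : E -> L0R P;
  rnorm_ge0 : forall x, 0 <= rnorm x;
  rnorm_eq0 : forall x, rnorm x = 0 <-> x = 0;
  rnormZ : forall (xi : L0C P) (x : E), rnorm (xi *: x) = L0_abs xi * rnorm x;
  rnormD : forall x y : E, rnorm (x + y) <= rnorm x + rnorm y
}.

#[short(type=rnModuleType)]
HB.structure Definition RNModule d (T : measurableType d) (R : realType)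
    (P : probability T R) :=
  {E of GRing.Lmodule (L0C P) E & Lmodule_isRNModule d T R P E}.

Section random_conjugate.
Context d (T : measurableType d) (R : realType) (P : probability T R).
Variable E : rnModuleType P.

Definition L0_bounded (f : E -> (L0C P)^o) : Prop :=
  exists xi : L0R P, 0 <= xi /\ forall x, L0_abs (f x) <= xi * rnorm x.

Definition random_conjugate_pred : {pred E -> (L0C P)^o} :=
  [pred f | `[< linear f /\ L0_bounded f >]].

Record random_conjugate := RandomConjugate {
  random_functional :> E -> (L0C P)^o;
  _ : random_functional \in random_conjugate_pred }.

HB.instance Definition _ := [isSub for random_functional].
HB.instance Definition _ := [Choice of random_conjugate by <:].

Let submod : submod_closed random_conjugate_pred.
Proof.
split=> [|xi f g /asboolP[fl [a [a0 fa]]] /asboolP[gl [b [b0 gb]]]]; apply/asboolP.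
  split; first by move=> a x y; rewrite scaler0 addr0.
  exists 0; split=> // x; apply/L0R_leP.
  apply: (ae_use (L0_absE (0 : L0C P))); apply: (ae_use (L0C_0E P)).
  apply: (ae_use (L0R_ME 0 (rnorm x))); apply: (ae_use (L0R_0E P)).
  by apply: aeW => t -> -> -> ->; rewrite mul0r normc0.
split.
  move=> c x y.
  have -> : (xi *: f + g) (c *: x + y) = xi *: f (c *: x + y) + g (c *: x + y) by [].
  have -> : (xi *: f + g) x = xi *: f x + g x by [].
  have -> : (xi *: f + g) y = xi *: f y + g y by [].
  rewrite (fl c x y) (gl c x y).
  by rewrite !scalerDr !scalerA addrACA [xi * c]mulrC.
exists (L0_abs xi * a + b); split.
  apply/L0R_leP.
  move/L0R_leP : a0 => a0; move/L0R_leP : b0 => b0.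
  apply: (ae_use a0); apply: (ae_use b0); apply: (ae_use (L0R_0E P)).
  apply: (ae_use (L0R_DE (L0_abs xi * a) b)).
  apply: (ae_use (L0R_ME (L0_abs xi) a)); apply: (ae_use (L0_absE xi)).
  by apply: aeW => t -> -> -> -> b0t a0t; rewrite addr_ge0// mulr_ge0// normc_ge0.
move=> x; apply/L0R_leP.
move/L0R_leP : (fa x) => fax; move/L0R_leP : (gb x) => gbx.
apply: (ae_use fax); apply: (ae_use gbx).
apply: (ae_use (L0_absE (f x))); apply: (ae_use (L0_absE (g x))).
apply: (ae_use (L0R_ME a (rnorm x))); apply: (ae_use (L0R_ME b (rnorm x))).
apply: (ae_use (L0R_ME (L0_abs xi * a + b) (rnorm x))).
apply: (ae_use (L0R_DE (L0_abs xi * a) b)).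
apply: (ae_use (L0R_ME (L0_abs xi) a)); apply: (ae_use (L0_absE xi)).
apply: (ae_use (L0_absE ((xi *: f + g) x))).
apply: (ae_use (L0C_DE (xi * f x) (g x))); apply: (ae_use (L0C_ME xi (f x))).
apply: aeW => t E1 E2 -> -> -> -> -> -> -> -> -> gt ft.
have -> : L0_repr ((xi *: f + g) x) t = L0_repr xi t * L0_repr (f x) t + L0_repr (g x) t.
  by rewrite -E1 -E2.
rewrite (le_trans (le_normcD _ _))// normcM mulrDl -mulrA lerD//.
by rewrite ler_wpM2l// normc_ge0.
Qed.

HB.instance Definition _ :=
  GRing.isSubmodClosed.Build _ _ random_conjugate_pred submod.
HB.instance Definition _ :=
  [SubChoice_isSubLmodule of random_conjugate by <:].

End random_conjugate.

Lemma rational_complex_dense (R : realType) (z : R[i]) (e : R) : 0 < e ->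
  exists p : rat * rat, normc (z - (ratr p.1 +i* ratr p.2)%C) < e.
Proof.
move=> e0; case: z => a b.
have [p pa] : exists p : rat, (ratr p : R) \in `]a, (a + e / 2)[.
  by apply: rat_in_itvoo; lra.
have [q qb] : exists q : rat, (ratr q : R) \in `]b, (b + e / 2)[.
  by apply: rat_in_itvoo; lra.
exists (p, q) => /=; set p' := ratr p; set q' := ratr q.
have {pa}pa : `|a - p'| < e / 2.
  by move: pa; rewrite in_itv/= -/p' => /andP[? ?]; rewrite ltr_norml; lra.
have {qb}qb : `|b - q'| < e / 2.
  by move: qb; rewrite in_itv/= -/q' => /andP[? ?]; rewrite ltr_norml; lra.
have nr x : normc (x +i* 0)%C = `|x| :> R.
  by rewrite /normc expr0n/= addr0 sqrtr_sqr.
have ni x : normc (0 +i* x)%C = `|x| :> R.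
  by rewrite /normc expr0n/= add0r sqrtr_sqr.
have := le_normcD ((a - p') +i* 0)%C (0 +i* (b - q'))%C; rewrite nr ni.
have -> : ((a - p') +i* 0 : Rcomplex R)%C + (0 +i* (b - q'))%C =
    ((a - p') +i* (b - q'))%C :> R[i].
  by congr Complex; rewrite /= ?addr0 ?add0r.
by move=> /le_lt_trans; apply; lra.
Qed.

(* The a.s. bounded functionals that are only assumed to be linear over C
   (acting through the constants) are L0-linear, so [random_conjugate] does not
   depend on which scalars linearity refers to. *)
Lemma L0_bounded_linear d (T : measurableType d) (R : realType)
    (P : probability T R) (E : rnModuleType P) (f : E -> (L0C P)^o) :
  (forall (c : R[i]) (x y : E),
    f ((L0_cst P c : L0C P) *: x + y) = (L0_cst P c : L0C P) *: f x + f y) ->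
  L0_bounded f -> linear f.
Proof.
move=> fl [xi [/L0R_leP xi0 fxi]].
have f1 x y : f (x + y) = f x + f y by have := fl 1 x y; rewrite !scale1r.
suff fZ eta x : f (eta *: x) = eta * f x by move=> eta x y; rewrite f1 fZ.
pose c (n : nat) : R[i] :=
  let p := odflt (0, 0) (unpickle n : option (rat * rat)) in
  (ratr p.1 +i* ratr p.2)%C.
have /ae_foralln h : forall n, {ae P, forall t,
    normc (L0_repr (f (eta *: x)) t - c n * L0_repr (f x) t) <=
    normc (L0_repr eta t - c n) * (xi t * rnorm x t)}.
  move=> n; pose k : L0C P := L0_cst P (c n); pose y := (eta - k) *: x.
  have fy : f (eta *: x) = k * f x + f y.
    by rewrite -[eta in LHS](addrNK k) addrC scalerDl fl.
  have /L0R_leP hy := fxi y.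
  have ny : rnorm y = L0_abs (eta - k) * rnorm x by rewrite /y rnormZ.
  rewrite ny in hy; rewrite fy.
  apply: (ae_use hy); apply: (ae_use (L0_absE (f y))).
  apply: (ae_use (L0R_ME xi (L0_abs (eta - k) * rnorm x))).
  apply: (ae_use (L0R_ME (L0_abs (eta - k)) (rnorm x))).
  apply: (ae_use (L0_absE (eta - k))); apply: (ae_use (L0C_DE eta (- k))).
  apply: (ae_use (L0C_NE k)); apply: (ae_use (L0_cstE P (c n))).
  apply: (ae_use (L0C_DE (k * f x) (f y))); apply: (ae_use (L0C_ME k (f x))).
  apply: aeW => t E1 E2 E3 E4 E5 E6 E7 -> ->.
  rewrite E7 E6 E5 E4 E3 => h.
  have -> : L0_repr (k * f x + f y) t - c n * L0_repr (f x) t = L0_repr (f y) t.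
    by rewrite [X in X - _]E2 E1 E3 addrAC subrr add0r.
  by rewrite mulrCA.
apply/L0P; apply: (ae_use h); apply: (ae_use (L0C_ME eta (f x))).
apply: (ae_use xi0); move/L0R_leP : (rnorm_ge0 x) => x0; apply: (ae_use x0).
apply: (ae_use (L0R_0E P)); apply: aeW => t -> x0t xi0t -> ht.
set u := L0_repr (f (eta *: x)) t in ht *; set v := L0_repr (f x) t in ht *.
set z := L0_repr eta t in ht *; set K := xi t * rnorm x t in ht.
have K0 : 0 <= K by exact: mulr_ge0.
have v0 := normc_ge0 v.
apply/eqP; rewrite -subr_eq0; apply/eqP/eq0_normc/eqP.
rewrite eq_le normc_ge0 andbT; apply/ler_addgt0Pr => e e0; rewrite add0r.
have KV : 0 < K + normc v + 1 by lra.
have [p zp] := rational_complex_dense z (divr_gt0 e0 KV).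
have := ht (pickle p); rewrite /c pickleK /=; set w := (_ +i* _)%C in zp *.
move=> hp; have -> : u - z * v = (u - w * v) + (w - z) * v.
  by rewrite mulrBl addrA subrK.
have wz : normc (w - z) = normc (z - w) by rewrite -normcN opprB.
rewrite (le_trans (le_normcD _ _))// normcM wz.
rewrite (le_trans (lerD hp (lexx _)))// -mulrDr.
have := normc_ge0 (z - w); move: zp; rewrite ltr_pdivlMr//.
set r := normc (z - w) => h1 h2; nra.
Qed.

Section dual_norm.
Context d (T : measurableType d) (R : realType) (P : probability T R).
Variable E : rnModuleType P.
Implicit Types (f g : random_conjugate E) (x y : E) (xi : L0C P).

Definition dual_norm f : L0R P :=
  supremum 0 [set L0_abs (f y) | y in [set y : E | rnorm y <= 1]].

Lemma random_conjugateP f : linear f /\ L0_bounded f.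
Proof. by have /asboolP := valP f. Qed.

Lemma random_conjugateZ f xi x : f (xi *: x) = xi * f x.
Proof.
have [fl _] := random_conjugateP f.
have f0 : f 0 = 0.
  have := fl 1 0 0; rewrite !scale1r addr0 => /esym/eqP.
  by rewrite -subr_eq0 addrK => /eqP.
by have := fl xi x 0; rewrite f0 !addr0.
Qed.

Lemma random_conjugateD f x y : f (x + y) = f x + f y.
Proof. by have [fl _] := random_conjugateP f; have := fl 1 x y; rewrite !scale1r. Qed.

Lemma random_conjugate0 f : f 0 = 0.
Proof. by have := random_conjugateZ f 0 0; rewrite scale0r mul0r. Qed.

Lemma random_conjugate_eqP f g : f = g <-> forall x, f x = g x.
Proof. by split=> [->//|fg]; apply: val_inj; apply/funext. Qed.

Lemma L0_abs0 : L0_abs (0 : L0C P) = 0.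
Proof.
apply/L0P; apply: (ae_use (L0_absE (0 : L0C P))).
apply: (ae_use (L0C_0E P)); apply: (ae_use (L0R_0E P)).
by apply: aeW => t -> -> ->; rewrite normc0.
Qed.

Lemma L0_abs_ge0 xi : 0 <= L0_abs xi.
Proof.
apply/L0R_leP; apply: (ae_use (L0_absE xi)); apply: (ae_use (L0R_0E P)).
by apply: aeW => t -> ->; rewrite normc_ge0.
Qed.

Lemma L0_abs_eq0 xi : L0_abs xi <= 0 -> xi = 0.
Proof.
move=> /L0R_leP h; apply/L0P; apply: (ae_use h); apply: (ae_use (L0_absE xi)).
apply: (ae_use (L0C_0E P)); apply: (ae_use (L0R_0E P)).
apply: aeW => t -> -> -> h0; apply: eq0_normc.
by apply/eqP; rewrite eq_le h0 normc_ge0.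
Qed.

Lemma rnorm0 : rnorm (0 : E) = 0.
Proof. by apply/rnorm_eq0. Qed.

Lemma L0R_ler01 : 0 <= 1 :> L0R P.
Proof.
apply/L0R_leP; apply: (ae_use (L0R_1E P)); apply: (ae_use (L0R_0E P)).
by apply: aeW => t -> ->.
Qed.

Lemma dual_norm_supremums f :
  supremums [set L0_abs (f y) | y in [set y : E | rnorm y <= 1]] (dual_norm f).
Proof.
rewrite /dual_norm /supremum.
have ne : [set L0_abs (f y) | y in [set y : E | rnorm y <= 1]] (L0_abs (f 0)).
  by exists 0 => //=; rewrite rnorm0 L0R_ler01.
case: ifPn => [/eqP e0|_]; first by rewrite e0 in ne.
apply: xgetPex.
have [_ [xi [xi0 fxi]]] := random_conjugateP f.
apply: (L0R_sup_exists (b := xi) ne) => _ [y /= y1 <-]; apply/L0R_leP.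
move/L0R_leP : xi0 => xi0; move/L0R_leP : y1 => y1; move/L0R_leP : (fxi y) => h.
apply: (ae_use xi0); apply: (ae_use y1); apply: (ae_use h).
apply: (ae_use (L0R_ME xi (rnorm y))); apply: (ae_use (L0R_0E P)).
apply: (ae_use (L0R_1E P)); apply: aeW => t -> -> -> h1 h2 h3.
by rewrite (le_trans h1)// ler_piMr.
Qed.

Lemma dual_norm_ub f y : rnorm y <= 1 -> L0_abs (f y) <= dual_norm f.
Proof. by move=> y1; have [ub _] := dual_norm_supremums f; apply: ub; exists y. Qed.

Lemma dual_norm_le f (c : L0R P) :
  (forall y, rnorm y <= 1 -> L0_abs (f y) <= c) -> dual_norm f <= c.
Proof.
by move=> fc; have [_ lb] := dual_norm_supremums f; apply: lb => _ [y /fc h <-].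
Qed.

Lemma dual_norm_ge0 f : 0 <= dual_norm f.
Proof.
by apply: (le_trans (L0_abs_ge0 (f 0))); apply: dual_norm_ub;
  rewrite rnorm0 L0R_ler01.
Qed.

Let inv (xi : L0R P) : L0R P := L0_lift1 (@measurable_realV R) xi.
Let invE (xi : L0R P) : {ae P, forall t, inv xi t = (xi t)^-1}.
Proof. exact: L0_lift1E. Qed.

Let toC (xi : L0R P) : L0C P := L0_lift1 (@measurable_real_complex R) xi.
Let toCE (xi : L0R P) : {ae P, forall t, toC xi t = (xi t)%:C%C}.
Proof. exact: L0_lift1E. Qed.

Let normcC (r : R) : normc r%:C%C = `|r|.
Proof. by rewrite /normc/= expr0n/= addr0 sqrtr_sqr. Qed.

Lemma L0_abs_le_dual_norm f x : L0_abs (f x) <= dual_norm f * rnorm x.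
Proof.
pose c := toC (inv (rnorm x)).
have cx1 : rnorm (c *: x) <= 1.
  rewrite rnormZ; apply/L0R_leP.
  apply: (ae_use (L0R_ME (L0_abs c) (rnorm x))); apply: (ae_use (L0_absE c)).
  apply: (ae_use (toCE (inv (rnorm x)))); apply: (ae_use (invE (rnorm x))).
  move/L0R_leP : (rnorm_ge0 x) => x0; apply: (ae_use x0).
  apply: (ae_use (L0R_0E P)); apply: (ae_use (L0R_1E P)).
  apply: aeW => t -> -> x0t -> -> -> ->; rewrite normcC ger0_norm ?invr_ge0//.
  by have [->|r0] := eqVneq (rnorm x t) 0; rewrite ?mulr0// mulVf.
have := dual_norm_ub f cx1; rewrite random_conjugateZ => /L0R_leP h.
have [_ [xi [_ /(_ x)/L0R_leP fxi]]] := random_conjugateP f.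
apply/L0R_leP; apply: (ae_use h); apply: (ae_use fxi).
apply: (ae_use (L0R_ME (dual_norm f) (rnorm x))); apply: (ae_use (L0R_ME xi (rnorm x))).
apply: (ae_use (L0_absE (c * f x))); apply: (ae_use (L0C_ME c (f x))).
apply: (ae_use (toCE (inv (rnorm x)))); apply: (ae_use (invE (rnorm x))).
move/L0R_leP : (rnorm_ge0 x) => x0; apply: (ae_use x0).
apply: (ae_use (L0R_0E P)); apply: (ae_use (L0_absE (f x))).
apply: aeW => t -> -> x0t E1 E2 E3 -> -> ->.
rewrite E3 E2 normcM normcC E1 ger0_norm ?invr_ge0//.
have [->|r0] := eqVneq (rnorm x t) 0; first by rewrite !mulr0.
by move=> fxt; rewrite ler_pdivrMl ?lt_neqAle 1?eq_sym ?r0// mulrC.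
Qed.

Let dual_norm_eq0 f : dual_norm f = 0 <-> f = 0.
Proof.
split=> [f0|->].
  apply/random_conjugate_eqP => x; apply: L0_abs_eq0.
  by have := L0_abs_le_dual_norm f x; rewrite f0 mul0r.
apply/eqP; rewrite eq_le dual_norm_ge0 andbT; apply: dual_norm_le => y _.
by rewrite [X in L0_abs X](_ : _ = (0 : L0C P))// L0_abs0.
Qed.

Let dual_normZ xi f : dual_norm (xi *: f) = L0_abs xi * dual_norm f.
Proof.
apply/eqP; rewrite eq_le; apply/andP; split.
  apply: dual_norm_le => y /(dual_norm_ub f) /L0R_leP h.
  have -> : (xi *: f) y = xi * f y by [].
  apply/L0R_leP; apply: (ae_use h).
  apply: (ae_use (L0R_ME (L0_abs xi) (dual_norm f))); apply: (ae_use (L0_absE xi)).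
  apply: (ae_use (L0_absE (xi * f y))); apply: (ae_use (L0C_ME xi (f y))).
  apply: (ae_use (L0_absE (f y))).
  by apply: aeW => t -> Et -> -> -> h1; rewrite Et normcM ler_wpM2l// normc_ge0.
pose N := dual_norm (xi *: f).
pose i := inv (L0_abs xi).
pose c := i * N + (1 - i * L0_abs xi) * dual_norm f.
have cE : {ae P, forall t, (c : L0R P) t =
    (normc (L0_repr xi t))^-1 * N t +
    (1 - (normc (L0_repr xi t))^-1 * normc (L0_repr xi t)) * dual_norm f t}.
  apply: (ae_use (L0R_DE (i * N) ((1 - i * L0_abs xi) * dual_norm f))).
  apply: (ae_use (L0R_ME i N)); apply: (ae_use (L0R_ME (1 - i * L0_abs xi) (dual_norm f))).
  apply: (ae_use (L0R_DE 1 (- (i * L0_abs xi)))); apply: (ae_use (L0R_NE (i * L0_abs xi))).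
  apply: (ae_use (L0R_ME i (L0_abs xi))); apply: (ae_use (L0R_1E P)).
  apply: (ae_use (invE (L0_abs xi))); apply: (ae_use (L0_absE xi)).
  by apply: aeW => t E1 E2 E3 E4 E5 E6 E7 E8 E9;
    rewrite E9 E8 E7 E6 E5 E4 E3 E2 E1.
have fc : dual_norm f <= c.
  apply: dual_norm_le => y y1.
  have := dual_norm_ub (xi *: f) y1.
  have -> : (xi *: f) y = xi * f y by [].
  move=> /L0R_leP h1; move/L0R_leP : (dual_norm_ub f y1) => h2.
  apply/L0R_leP; apply: (ae_use h1); apply: (ae_use h2); apply: (ae_use cE).
  apply: (ae_use (L0_absE (xi * f y))); apply: (ae_use (L0C_ME xi (f y))).
  apply: (ae_use (L0_absE (f y))); apply: aeW => t -> E1 -> -> h3.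
  rewrite E1 normcM => h4.
  have [->|x0] := eqVneq (normc (L0_repr xi t)) 0.
    by rewrite mulr0 subr0 mul1r invr0 mul0r add0r.
  rewrite mulVf// subrr mul0r addr0.
  by rewrite ler_pdivlMl// lt_neqAle eq_sym x0 normc_ge0.
move/L0R_leP : fc => fc; move/L0R_leP : (dual_norm_ge0 (xi *: f)) => N0.
apply/L0R_leP; apply: (ae_use fc); apply: (ae_use N0); apply: (ae_use cE).
apply: (ae_use (L0R_ME (L0_abs xi) (dual_norm f))); apply: (ae_use (L0_absE xi)).
apply: (ae_use (L0R_0E P)); apply: aeW => t -> -> -> -> N0t.
have [->|x0] := eqVneq (normc (L0_repr xi t)) 0; first by rewrite mul0r.
rewrite mulVf// subrr mul0r addr0.
by rewrite ler_pdivlMl// lt_neqAle eq_sym x0 normc_ge0.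
Qed.

Let dual_normD f g : dual_norm (f + g) <= dual_norm f + dual_norm g.
Proof.
apply: dual_norm_le => y y1.
move/L0R_leP : (dual_norm_ub f y1) => h1; move/L0R_leP : (dual_norm_ub g y1) => h2.
have -> : (f + g) y = f y + g y by [].
apply/L0R_leP; apply: (ae_use h1); apply: (ae_use h2).
apply: (ae_use (L0R_DE (dual_norm f) (dual_norm g))).
apply: (ae_use (L0_absE (f y + g y))); apply: (ae_use (L0C_DE (f y) (g y))).
apply: (ae_use (L0_absE (f y))); apply: (ae_use (L0_absE (g y))).
apply: aeW => t -> -> Et -> -> h3 h4.
by rewrite Et (le_trans (le_normcD _ _))// lerD.
Qed.

HB.instance Definition _ := Lmodule_isRNModule.Build d T R P (random_conjugate E)
  dual_norm_ge0 dual_norm_eq0 dual_normZ dual_normD.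

End dual_norm.

Section random_natural_embedding.
Context d (T : measurableType d) (R : realType) (P : probability T R).
Variable E : rnModuleType P.

Lemma evaluation_random_conjugate (x : E) :
  (fun g : random_conjugate E => g x) \in
    @random_conjugate_pred _ _ _ _ (random_conjugate E).
Proof.
apply/asboolP; split=> //; exists (rnorm x); split; first exact: rnorm_ge0.
by move=> g; rewrite mulrC; exact: L0_abs_le_dual_norm.
Qed.

Definition random_embedding (x : E) : random_conjugate (random_conjugate E) :=
  RandomConjugate (evaluation_random_conjugate x).

End random_natural_embedding.

Section weak_star.
Context d (T : measurableType d) (R : realType) (P : probability T R).
Variable F : rnModuleType P.

Definition abs_lt_event (xi : L0C P) (eps : R) : set T :=
  [set t | (L0_abs xi : L0R P) t < eps].

Definition weak_star_base (s : seq F) (eps lambda : R) : set (random_conjugate F) :=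
  [set g | forall y, y \in s ->
     ((1 - lambda)%:E < P (abs_lt_event (g y) eps))%E].

(* An alias of F* on which the (epsilon, lambda) weak star topology sigma(F*, F)
   can be canonical. *)
Definition weak_star : Type := random_conjugate F.

Definition weak_star_nbhs (p : weak_star) : set_system weak_star :=
  [set A | exists (s : seq F) (eps lambda : R),
    [/\ s != [::], 0 < eps, 0 < lambda < 1 &
        [set (p : random_conjugate F) + g | g in weak_star_base s eps lambda]
          `<=` A]].

HB.instance Definition _ := Choice.on weak_star.
HB.instance Definition _ := hasNbhs.Build weak_star weak_star_nbhs.

Lemma measurable_abs_lt_event xi eps : measurable (abs_lt_event xi eps).
Proof.
rewrite -[X in measurable X]setTI.
by apply: measurable_fun_ltr => //; exact: measurable_funPT.
Qed.

Lemma le_probability_ae (A B : set T) : measurable A -> measurable B ->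
  {ae P, forall t, A t -> B t} -> (P A <= P B)%E.
Proof.
move=> mA mB [N [mN PN0 NS]].
rewrite (le_trans (y := P (B `|` N)))//.
  apply: le_measure; rewrite ?inE//; first exact: measurableU.
  by move=> t At; have [Bt|nBt] := pselect (B t); [left|right; apply: NS => /(_ At)].
apply: (le_trans (measureU2 _ mB mN)).
rewrite -[leRHS]adde0; apply: leeD => //.
by rewrite le_eqVlt; apply/orP; left; apply/eqP; exact: PN0.
Qed.

Let base0 s eps lambda : 0 < eps -> 0 < lambda -> weak_star_base s eps lambda 0.
Proof.
move=> eps0 lambda0 y _; rewrite (@lt_le_trans _ _ 1%E)//.
  by rewrite lte_fin ltrBlDr ltrDl.
rewrite -(probability_setT P); apply: le_probability_ae => //.
  exact: measurable_abs_lt_event.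
apply: (ae_use (L0_absE (0 : L0C P))); apply: (ae_use (L0C_0E P)).
apply: aeW => t z0 z1 _; rewrite /abs_lt_event /=.
have -> : L0_repr (L0_abs ((0 : random_conjugate F) y)) t = 0.
  by rewrite [LHS]z1 z0 normc0.
by [].
Qed.

Let baseI s1 s2 e1 e2 l1 l2 :
  weak_star_base (s1 ++ s2) (Num.min e1 e2) (Num.min l1 l2) `<=`
  weak_star_base s1 e1 l1 `&` weak_star_base s2 e2 l2.
Proof.
move=> g gs; split=> y ys.
- have := gs y; rewrite mem_cat ys => /(_ isT) h.
  rewrite (@le_lt_trans _ _ (1 - Num.min l1 l2)%:E)//.
    by rewrite lee_fin lerB// ge_min lexx.
  rewrite (lt_le_trans h)// le_measure ?inE//; try exact: measurable_abs_lt_event.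
  by move=> t; rewrite /abs_lt_event/= lt_min => /andP[].
- have := gs y; rewrite mem_cat ys orbT => /(_ isT) h.
  rewrite (@le_lt_trans _ _ (1 - Num.min l1 l2)%:E)//.
    by rewrite lee_fin lerB// ge_min lexx orbT.
  rewrite (lt_le_trans h)// le_measure ?inE//; try exact: measurable_abs_lt_event.
  by move=> t; rewrite /abs_lt_event/= lt_min => /andP[].
Qed.

Let baseD s eps lambda g h :
  weak_star_base s (eps / 2) (lambda / 2) g ->
  weak_star_base s (eps / 2) (lambda / 2) h ->
  weak_star_base s eps lambda (g + h).
Proof.
move=> gs hs y ys.
set A := abs_lt_event (g y) (eps / 2); set B := abs_lt_event (h y) (eps / 2).
have mA : measurable A by exact: measurable_abs_lt_event.
have mB : measurable B by exact: measurable_abs_lt_event.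
rewrite (@lt_le_trans _ _ (P (A `&` B)))//; last first.
  apply: le_probability_ae; first exact: measurableI.
    exact: measurable_abs_lt_event.
  apply: (ae_use (L0_absE (g y + h y))); apply: (ae_use (L0C_DE (g y) (h y))).
  apply: (ae_use (L0_absE (g y))); apply: (ae_use (L0_absE (h y))).
  apply: aeW => t; rewrite /A /B /abs_lt_event /= => -> -> E1 E2 [a1 b1].
  have -> : L0_repr (L0_abs ((g + h) y)) t = normc (L0_repr (g y) t + L0_repr (h y) t).
    by rewrite [LHS]E2 E1.
  by rewrite (le_lt_trans (le_normcD _ _))// (splitr eps) ltrD.
have AB1 : (P A + P B <= P (A `&` B) + 1)%E.
  have UAB : P (A `|` B) = (P A + P B - P (A `&` B))%E.
    apply: measureUfinl => //.
    by rewrite (le_lt_trans (probability_le1 P mA))// ltry.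
  have : (P (A `|` B) <= 1)%E by apply: probability_le1; exact: measurableU.
  have PABf : P (A `&` B) \is a fin_num.
    by apply: fin_num_measure; exact: measurableI.
  rewrite UAB leeBlDr//.
  by rewrite [X in (_ <= X)%E -> _]addeC.
have := lteD (gs y ys) (hs y ys); rewrite -/A -/B -EFinD => /lt_le_trans/(_ AB1).
rewrite -lteBlDr// => /(le_lt_trans _); apply.
by rewrite -EFinB lee_fin; lra.
Qed.

Let nbhs_pfilter (p : weak_star) : ProperFilter (nbhs p).
Proof.
apply: Build_ProperFilter_ex.
  move=> A [s [eps [lambda [s0 e0 /andP[l0 l1] sA]]]].
  by exists ((p : random_conjugate F) + 0); apply: sA; exists 0 => //; exact: base0.
split.
- by exists [:: 0], 1, 2^-1; split=> //; rewrite ?ltr01 ?invr_gt0 ?invf_lt1// ?ltr1n ?ltr0n.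
- move=> A B [s1 [e1 [l1 [s10 e10 /andP[l10 l11] sA]]]]
    [s2 [e2 [l2 [s20 e20 /andP[l20 l21] sB]]]].
  exists (s1 ++ s2), (Num.min e1 e2), (Num.min l1 l2); split.
  + by case: s1 s10 {sA}.
  + by rewrite lt_min e10.
  + by rewrite lt_min l10 l20 gt_min l11.
  + by move=> _ [g /baseI[g1 g2] <-]; split; [apply: sA|apply: sB]; exists g.
- move=> A B AB [s [eps [lambda [s0 e0 l0 sA]]]].
  by exists s, eps, lambda; split=> //; exact: subset_trans AB.
Qed.

Let nbhs_single (p : weak_star) (A : set weak_star) : nbhs p A -> A p.
Proof.
move=> [s [eps [lambda [s0 e0 /andP[l0 l1] sA]]]].
by apply: sA; exists 0; [exact: base0|rewrite addr0].
Qed.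

Let nbhs_nbhs_nbhs (p : weak_star) (A : set weak_star) :
  nbhs p A -> nbhs p (nbhs^~ A).
Proof.
move=> [s [eps [lambda [s0 e0 /andP[l0 l1] sA]]]].
have l2 : 0 < lambda / 2 < 1 by apply/andP; split; lra.
have e2 : 0 < eps / 2 by lra.
exists s, (eps / 2), (lambda / 2); split=> // _ [g gs <-].
exists s, (eps / 2), (lambda / 2); split=> // _ [h hs <-].
by apply: sA; exists (g + h); [exact: baseD|rewrite addrA].
Qed.

HB.instance Definition _ := Nbhs_isNbhsTopological.Build weak_star
  nbhs_pfilter nbhs_single nbhs_nbhs_nbhs.

End weak_star.

(* Main.v *)
Require Import Defs.
From mathcomp Require Import all_boot all_order all_algebra.
From mathcomp Require Import all_classical all_reals all_analysis.
From mathcomp Require Import measurable_realfun complex ring.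

(** No Hahn-Banach argument is needed. For [phi] in [E**] and finitely many
    [g_1, ..., g_n] in [E*], Gaussian elimination over [L0] produces an [x] with
    [g_i x = phi g_i] for all [i] outside a set of small probability. Up to small
    probability some [e] satisfies [g_1 e = 1] on the essential support of [g_1];
    solving the problem for the [g_i - (g_i e) g_1], [i > 1], by induction, one
    corrects the solution [x] to [x + (phi g_1 - g_1 x) e]. Outside the support
    of [g_1], some indicator annihilates [g_1], hence also [phi g_1]. *)

Local Open Scope classical_set_scope.

(** * Measurability of the complex inverse and of complex indicators *)

Section complex_inverse.
Local Open Scope ring_scope.
Import GRing.Theory.
Variable R : realType.

Lemma measurable_complexV : measurable_fun [set: R[i]] (fun z : R[i] => z^-1).
Proof.
have mn : measurable_fun [set: R[i]]
    (fun z : R[i] => (complex.Re z ^+ 2 + complex.Im z ^+ 2)^-1).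
  apply: (measurableT_comp (@measurable_realV R)).
  by apply: measurable_funD; apply: measurable_funX;
    [exact: measurable_Re|exact: measurable_Im].
apply/measurable_complexP; split.
(* The formula conj z / |z|^2 for the inverse also holds at 0, where both sides are 0. *)
- rewrite [X in measurable_fun _ X](_ : _ = fun z : R[i] =>
      complex.Re z * (complex.Re z ^+ 2 + complex.Im z ^+ 2)^-1); last first.
    by apply/funext => -[a b].
  by apply: measurable_funM => //; exact: measurable_Re.
- rewrite [X in measurable_fun _ X](_ : _ = fun z : R[i] =>
      (- complex.Im z) * (complex.Re z ^+ 2 + complex.Im z ^+ 2)^-1); last first.
    by apply/funext => -[a b] /=; rewrite mulNr.
  apply: measurable_funM => //.
  exact: (measurableT_comp (@oppr_measurable R _) (@measurable_Im R)).
Qed.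

Lemma measurable_indicC d (T : measurableType d) (A : set T) :
  measurable A -> measurable_fun [set: T] (fun t => (\1_A t : R)%:C%C).
Proof.
move=> mA; apply: (measurableT_comp (@measurable_real_complex R)).
exact: measurable_indic.
Qed.

End complex_inverse.

(** * Supports of random variables *)

Section essential_support.
Set Implicit Arguments.
Unset Strict Implicit.
Import Order.TTheory GRing.Theory Num.Theory.
Local Open Scope ring_scope.
Context d (T : measurableType d) (R : realType) (P : probability T R).
Implicit Types xi eta : L0C P.

(** Since [0^-1 = 0], the product [L0_inv xi * xi] is the indicator of the support of [xi], not 1 in
    general. *)
Definition L0_inv xi : L0C P := L0_lift1 (@measurable_complexV R) xi.

Lemma L0_invE xi : {ae P, forall t, L0_inv xi t = (xi t)^-1}.
Proof. exact: L0_lift1E. Qed.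

Definition L0_indic (A : set T) (mA : measurable A) : L0C P :=
  L0_class P (mfun_of (@measurable_indicC R _ _ _ mA)).

Lemma L0_indicE (A : set T) (mA : measurable A) :
  {ae P, forall t, L0_indic mA t = (\1_A t : R)%:C%C}.
Proof. exact: L0_classK. Qed.

(** The set depends on the chosen representative, so it is meaningful only up to a null set. *)
Definition L0_supp xi : set T := [set t | L0_repr xi t != 0].

Lemma measurable_L0_supp xi : measurable (L0_supp xi).
Proof.
have -> : L0_supp xi = [set t | 0 < ComplexField.Normc.normc (L0_repr xi t)].
  apply/seteqP; split => t; rewrite /L0_supp/= lt_neqAle normc_ge0 andbT.
    move=> x0; rewrite eq_sym; apply: contra_neq x0.
    exact: ComplexField.Normc.eq0_normc.
  by apply: contra_neq => ->; rewrite ComplexField.Normc.normc0.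
rewrite -[X in measurable X]setTI.
apply: measurable_fun_ltr => //.
exact: (measurableT_comp (@measurable_normc R) (@measurable_funPT _ _ _ _ _)).
Qed.

(** * The essential support of a functional, by exhaustion *)

Section pivot.
Variables (E : rnModuleType P) (g : random_conjugate E).

(** Adding [y] only where [g x] vanishes prevents any cancellation between [g x] and [g y]. *)
Lemma supp_join (x y : E) : exists z : E, {ae P, forall t,
  L0_supp (g z) t <-> L0_supp (g x) t \/ L0_supp (g y) t}.
Proof.
have mx := measurable_L0_supp (g x).
pose c := L0_indic (measurableC mx).
exists (x + c *: y); rewrite random_conjugateD random_conjugateZ.
apply: (ae_use (L0C_DE (g x) (c * g y))); apply: (ae_use (L0C_ME c (g y))).
apply: (ae_use (L0_indicE (measurableC mx))).
apply: aeW => t; rewrite -/c => E1 E2 E3.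
have E4 : L0_repr (g x + c * g y) t = L0_repr (g x) t +
    (\1_(~` L0_supp (g x)) t : R)%:C%C * L0_repr (g y) t.
  by rewrite -E1 -E2.
rewrite /L0_supp/= E4 indicE in_setC.
have [x0|x0] := eqVneq (L0_repr (g x) t) 0.
  rewrite memNset/= /L0_supp/= ?x0 ?eqxx// mul1r add0r.
  by split=> [|[]//]; right.
rewrite mem_set//= mul0r addr0; split=> //; by left.
Qed.

Let alpha := ereal_sup [set P (L0_supp (g e)) | e in [set: E]].

Let le_alpha e : (P (L0_supp (g e)) <= alpha)%E.
Proof. by apply: ereal_sup_ubound; exists e. Qed.

Let alpha_fin : alpha \is a fin_num.
Proof.
rewrite ge0_fin_numE.
  rewrite (@le_lt_trans _ _ 1%E) ?ltry//.
  by apply: ge_ereal_sup => _ [e _ <-]; exact/probability_le1/measurable_L0_supp.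
by rewrite (le_trans _ (le_alpha 0)).
Qed.

Let exu (n : nat) : exists e : E, (alpha - n.+1%:R^-1%:E < P (L0_supp (g e)))%E.
Proof.
have [|_ [e _ <-] h] := @ub_ereal_sup_adherent _
    [set P (L0_supp (g e)) | e in [set: E]] n.+1%:R^-1 _ alpha_fin.
  by rewrite invr_gt0.
by exists e.
Qed.

Let u n : E := sval (cid (exu n)).
Let S n : set T := L0_supp (g (u n)).
(** The union of a maximizing sequence of supports: this is the essential support of [g]. *)
Let A := \bigcup_n S n.

Let uP n : (alpha - n.+1%:R^-1%:E < P (S n))%E.
Proof. by rewrite /S /u; case: cid. Qed.

Let mS n : measurable (S n). Proof. exact: measurable_L0_supp. Qed.

Let mA : measurable A.
Proof. by apply: bigcupT_measurable. Qed.

(** By [supp_join], each finite union of the [S k] is a.s. the support of a single [g e], hence has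
    probability at most [alpha]; continuity from below passes to [A]. *)
Let PA_le : (P A <= alpha)%E.
Proof.
have fin n : exists e : E, {ae P, forall t,
    L0_supp (g e) t <-> (\big[setU/set0]_(k < n) S k) t}.
  elim: n => [|n [e he]].
    exists 0; rewrite random_conjugate0 big_ord0.
    apply: (ae_use (L0C_0E P)); apply: aeW => t.
    by rewrite /L0_supp/= => ->; rewrite eqxx; split.
  have [z hz] := supp_join e (u n); exists z.
  apply: (ae_use he); apply: (ae_use hz); apply: aeW => t hz1 he1.
  by rewrite big_ord_recr/= hz1 he1.
have mF n : measurable (\big[setU/set0]_(k < n) S k).
  exact: bigsetU_measurable.
have := @nondecreasing_cvg_mu _ _ _ P
  (fun n => \big[setU/set0]_(k < n.+1) S k) (fun n => mF n.+1).
have ndF : {homo (fun n => \big[setU/set0]_(k < n.+1) S k) :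
    n m / (n <= m)%N >-> (n <= m)%O}.
  by move=> n m nm; exact/subsetPset/subset_bigsetU.
rewrite bigcup_bigsetU_bigcup => /(_ mA ndF) h.
rewrite -(cvg_lim _ h)//; apply: lime_le; first by apply/cvg_ex; exists (P A).
apply: nearW => n /=; have [e he] := fin n.+1.
apply: (le_trans _ (le_alpha e)); apply: le_probability_ae.
- exact: mF n.+1.
- exact: measurable_L0_supp.
- by apply: filterS he => t ->.
Qed.

(** Joining [x] to [u n] gives a support containing the disjoint sets [S n] and [L0_supp (g x)]
    minus [A]. Its probability is at most [alpha], so the second set has probability at most
    [n.+1%:R^-1] for every [n]. *)
Let supp_ae x : {ae P, forall t, L0_supp (g x) t -> A t}.
Proof.
have mx := measurable_L0_supp (g x).
have mD : measurable (L0_supp (g x) `\` A) by exact: measurableD.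
exists (L0_supp (g x) `\` A); split => //; last first.
  move=> t /=; apply: contra_notP => h xt.
  by apply: contrapT => nA; apply: h.
apply/eqP; rewrite eq_le measure_ge0 andbT; apply/lee_addgt0Pr => e e0.
rewrite add0e; have [n] := ltr_add_invr e0; rewrite add0r => /ltW ne.
have [z hz] := supp_join x (u n).
have : (P (S n `|` (L0_supp (g x) `\` A)) <= alpha)%E.
  apply: (le_trans _ (le_alpha z)); apply: le_probability_ae.
  - exact: measurableU.
  - exact: measurable_L0_supp.
  - by apply: filterS hz => t -> [Snt|[]]; [right|left].
rewrite measureU//; last first.
  by rewrite -subset0 => t [Snt [_]]; apply; exists n.
have If : P (S n) \is a fin_num by exact: fin_num_measure.
rewrite addeC -leeBrDr// => /le_trans; apply.
rewrite leeBlDl// -leeBlDr//.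
by apply: le_trans (ltW (uP n)); apply: leeB.
Qed.

(* [c] is the indicator of the complement of the essential support of [g], and
   [N] the part of that support on which [g e] vanishes. *)
Lemma exists_pivot (lambda : R) : 0 < lambda ->
  exists (e : E) (c : L0C P) (N : set T),
  [/\ measurable N, (P N <= lambda%:E)%E, c *: g = 0 &
   {ae P, forall t, N t \/ L0_repr (g e) t = 1 \/ L0_repr c t = 1}].
Proof.
move=> l0; have [n] := ltr_add_invr l0; rewrite add0r => /ltW nl.
pose c := L0_indic (measurableC mA).
(* Rescaling [u n] makes the value of [g] equal to 1 on [S n], which exhausts [A] up to
   [n.+1%:R^-1 <= lambda]. *)
exists (L0_inv (g (u n)) *: u n), c, (A `\` S n).
have If : P (S n) \is a fin_num by exact: fin_num_measure.
split.
- exact: measurableD.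
- rewrite measureD//; last by rewrite (le_lt_trans (probability_le1 P mA))// ltry.
  rewrite setIidr; last by move=> t Snt; exists n.
  rewrite leeBlDl// -leeBlDr//; apply: le_trans (ltW (uP n)).
  by apply: leeB.
- apply/random_conjugate_eqP => x; apply/L0P.
  apply: (ae_use (supp_ae x)); apply: (ae_use (L0C_ME c (g x))).
  apply: (ae_use (L0_indicE (measurableC mA))); apply: (ae_use (L0C_0E P)).
  apply: aeW => t E0 E1 E2 xA; rewrite [RHS]E0 [LHS]E2 E1 indicE in_setC.
  have [x0|/xA At] := eqVneq (L0_repr (g x) t) 0; first by rewrite x0 mulr0.
  by rewrite mem_set// mul0r.
- rewrite random_conjugateZ; set h := g (u n).
  apply: (ae_use (L0_invE h)); apply: (ae_use (L0C_ME (L0_inv h) h)).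
  apply: (ae_use (L0_indicE (measurableC mA))).
  apply: aeW => t E1 E2 E3.
  have [At|nAt] := pselect (A t); last first.
    by right; right; rewrite E1 indicE mem_set.
  have [h0|h0] := eqVneq (L0_repr h t) 0.
    by left; split=> //; rewrite /S /L0_supp/= -/h h0 eqxx.
  by right; left; rewrite E2 E3 mulVf.
Qed.

End pivot.

(** * Interpolation by Gaussian elimination, and density *)

Section interpolation.
Variable E : rnModuleType P.
Variable phi : random_conjugate (random_conjugate E).

Lemma interpolation (s : seq (random_conjugate E)) (lambda : R) : 0 < lambda ->
  exists (x : E) (N : set T), [/\ measurable N, (P N <= lambda%:E)%E &
    forall g, g \in s ->
      {ae P, forall t, N t \/ L0_repr (g x) t = L0_repr (phi g) t}].
Proof.
(* Induction on the length, since the recursive call is on [map r s] and not on a tail of [s]. *)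
move: {2}(size s) (erefl (size s)) => n.
elim: n s lambda => [|n IH] [|g0 s]// lambda /=.
  by move=> _ l0; exists 0, set0; split=> //; rewrite measure0 lee_fin ltW.
move=> [sn] l0; have l2 : 0 < lambda / 2 by rewrite divr_gt0.
have [e [c [N1 [mN1 PN1 cg He]]]] := exists_pivot g0 l2.
pose r (g : random_conjugate E) : random_conjugate E :=
  g - (g e : L0C P) *: g0.
have [|x [N2 [mN2 PN2 Hx]]] := IH (map r s) (lambda / 2) _ l2.
  by rewrite size_map.
pose k : L0C P := phi g0 - g0 x.
exists (x + k *: e), (N1 `|` N2); split.
- exact: measurableU.
- rewrite (le_trans (measureU2 _ mN1 mN2))//.
  by rewrite [lambda in leRHS]splitr EFinD leeD.
have valE (g : random_conjugate E) : g (x + k *: e) = g x + k * g e.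
  by rewrite random_conjugateD random_conjugateZ.
have g0E : {ae P, forall t,
    N1 t \/ L0_repr (g0 (x + k *: e)) t = L0_repr (phi g0) t}.
  (* Where [c] is 1, the values [phi g0], [g0 x] and [g0 e] all vanish and the equation reads 0 = 0;
     where [g0 e] is 1, it follows from the choice of [k]. *)
  have cphi : c * phi g0 = 0 by rewrite -random_conjugateZ cg random_conjugate0.
  have cval y : c * g0 y = 0.
    by move/random_conjugate_eqP : cg => /(_ y).
  rewrite valE; have := L0C_ME c (phi g0); rewrite cphi => h1.
  have := L0C_ME c (g0 x); rewrite cval => h2.
  have := L0C_ME c (g0 e); rewrite cval => h3.
  apply: (ae_use He); apply: (ae_use h1); apply: (ae_use h2).
  apply: (ae_use h3); apply: (ae_use (L0C_0E P)).
  apply: (ae_use (L0C_DE (g0 x) (k * g0 e))); apply: (ae_use (L0C_ME k (g0 e))).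
  apply: (ae_use (L0C_DE (phi g0) (- g0 x))); apply: (ae_use (L0C_NE (g0 x))).
  apply: aeW => t E1 E2 E3 E4 z0 a1 a2 a3 [|h]; [by left|right].
  rewrite [LHS]E4 E3 E2 E1; case: h => [->|c1].
    by rewrite mulr1 addrC subrK.
  by move: a1 a2 a3; rewrite z0 c1 !mul1r => <- <- <-; rewrite mulr0 addr0.
move=> g; rewrite in_cons => /predU1P[->|gs].
  by apply: filterS g0E => t [|->]; [left; left|right].
(* By linearity of [phi], the equation [r g x = phi (r g)] rearranges to [g x + k * g e = phi g], so
   it holds off [N2]. *)
have := Hx (r g) (map_f r gs).
have -> : r g x = g x - g e * g0 x by [].
have -> : phi (r g) = phi g - g e * phi g0.
  rewrite /r random_conjugateD; congr (_ + _).
  by rewrite -scaleN1r random_conjugateZ random_conjugateZ mulN1r.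
move=> h; rewrite valE.
apply: (ae_use h).
apply: (ae_use (L0C_DE (g x) (- (g e * g0 x)))); apply: (ae_use (L0C_NE (g e * g0 x))).
apply: (ae_use (L0C_ME (g e) (g0 x))).
apply: (ae_use (L0C_DE (phi g) (- (g e * phi g0)))).
apply: (ae_use (L0C_NE (g e * phi g0))); apply: (ae_use (L0C_ME (g e) (phi g0))).
apply: (ae_use (L0C_DE (g x) (k * g e))); apply: (ae_use (L0C_ME k (g e))).
apply: (ae_use (L0C_DE (phi g0) (- g0 x))); apply: (ae_use (L0C_NE (g0 x))).
apply: aeW => t E1 E2 E3 E4 E5 E6 E7 E8 E9 E10 [|]; first by left; right.
rewrite E10 E9 E8 [X in _ = X -> _]E7 E6 E5 => /eqP; rewrite subr_eq => /eqP q.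
right; rewrite [LHS]E4 E3 E2 E1 q; ring.
Qed.

(** Interpolation is exact off [N], so the difference there is 0, below any [eps]. *)
Lemma random_embedding_approx (s : seq (random_conjugate E)) (eps lambda : R) :
  0 < eps -> 0 < lambda ->
  exists x, weak_star_base s eps lambda (random_embedding x - phi).
Proof.
move=> e0 l0; have l2 : 0 < lambda / 2 by rewrite divr_gt0.
(* Half of [lambda] leaves room for the strict inequality in [weak_star_base]. *)
have [x [N [mN PN Hx]]] := interpolation s l2.
exists x => g gs.
have h1 : ((1 - lambda)%:E < P (~` N))%E.
  rewrite probability_setC// (@lt_le_trans _ _ (1 - (lambda / 2)%:E)%E)//.
    by rewrite -EFinB lte_fin ltrD2l ltrN2 ltr_pdivrMr// ltr_pMr// ltr1n.
  exact: leeB.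
apply: (lt_le_trans h1); apply: le_probability_ae.
- exact: measurableC.
- exact: measurable_abs_lt_event.
have -> : (random_embedding x - phi) g = g x - phi g :> L0C P by [].
apply: (ae_use (Hx g gs)); apply: (ae_use (L0_absE (g x - phi g : L0C P))).
apply: (ae_use (L0C_DE (g x) (- phi g))); apply: (ae_use (L0C_NE (phi g))).
apply: aeW => t E1 E2 E3 [//|q] _; rewrite /abs_lt_event/= E3 E2 E1 q.
by rewrite subrr ComplexField.Normc.normc0.
Qed.

End interpolation.
End essential_support.

Theorem theorem4p3 (d : measure_display) (T : measurableType d) (R : realType)
    (P : probability T R) (E : rnModuleType P) :
  closure (range (@random_embedding d T R P E)
    : set (weak_star (random_conjugate E))) = [set: weak_star (random_conjugate E)].
Proof.
apply/seteqP; split=> // phi _ B [s [eps [lambda [_ e0 /andP[l0 _] sB]]]].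
have [x xs] := random_embedding_approx phi s e0 l0.
exists (random_embedding x); split; first by exists x.
apply: sB; exists (random_embedding x - phi)%R => //.
by rewrite GRing.addrC GRing.subrK.
Qed.
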